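(* There is a universal constant $C>0$ such that for every $n$-point metric space $(X,d)$ with $n\ge 2$ and every $1\le p\le\infty$, $$c_p(X)\le C\,\alpha_X^{1-1/p}(\log n)^{1/p}.$$
   Context: $B(x,r)=\{y\in X: d(x,y)<r\}$ denotes the open ball. A mapping $f:X\to Y$ between metric spaces is $K$-bi-Lipschitz if there is $c>0$ with $cK^{-1}d_X(x,y)\le d_Y(f(x),f(y))\le c\,d_X(x,y)$ for all $x,y$; the least such $K$ is the distortion of $f$, and $c_p(X)$ is the least distortion of an embedding of $X$ into $L_p$. For a partition $P$ of $X$ and $x\in X$, $P(x)$ is the cluster of $P$ containing $x$. Given $\Delta>0$ and $\varepsilon:X\to(0,1]$, a $\Delta$-bounded $\varepsilon$-padded (stochastic) decomposition of $X$ is a probability distribution over partitions of $X$ such that (1) every cluster $C$ of every partition in its support has $\operatorname{diam}(C)\le\Delta$, and (2) for every $x\in X$, $\Pr[B(x,\varepsilon(x)\Delta)\not\subseteq P(x)]\le 1/2$. Given $\varepsilon:X\times\mathbb Z\to(0,1]$, an $\varepsilon$-padded decomposition bundle is a function $\beta$ assigning to each $u\in\mathbb Z$ a $2^u$-bounded $\varepsilon(\cdot,u)$-padded stochastic decomposition of $X$. The modulus of padded decomposability is $\alpha_X=\inf\{\alpha:$ there exists an $\varepsilon$-padded decomposition bundle on $X$ with $\varepsilon(x,u)\equiv 1/\alpha\}$. $\log$ is the natural logarithm. *)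

(* Defs.v *)
From HB Require Import structures.
From mathcomp Require Import all_boot all_order all_algebra.
From mathcomp Require Import all_classical all_reals all_analysis.

Set Implicit Arguments.
Unset Strict Implicit.
Unset Printing Implicit Defensive.

Import Order.TTheory GRing.Theory Num.Theory.
Import numFieldNormedType.Exports.

Local Open Scope classical_set_scope.
Local Open Scope ring_scope.

#[short(type="finMetricType")]
HB.structure Definition FinMetric (R : numDomainType) :=
  {T of Finite T & Metric R T}.

Section Embeddings.
Variable R : realType.

(* Lebesgue measure on [0, 1], as a measure on R vanishing outside [0, 1];
   "L_p" is the space L_p([0, 1]) of classes of functions modulo a.e. equality. *)
Definition unit_measure : {measure set (measurableTypeR R) -> \bar R} :=
  mrestr lebesgue_measure (measurable_itv `[0, 1]).

Definition Lp (p : \bar R) (p1 : (1 <= p)%E) : Type := LspaceType unit_measure p1.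

Definition Lp_dist (p : \bar R) (p1 : (1 <= p)%E) (f g : Lp p1) : \bar R :=
  'N[unit_measure]_p[EFin \o (f \- g : R -> R)%R]%E.

Variable T : finMetricType R.

Definition bi_lipschitz (p : \bar R) (p1 : (1 <= p)%E) (K : R) (f : T -> Lp p1) :=
  exists2 c : R, 0 < c &
    forall x y : T,
      ((c * K^-1 * mdist x y)%:E <= Lp_dist (f x) (f y) <= (c * mdist x y)%:E)%E.

(* K ranges over positive reals only: the lower bound is void for K <= 0.  The
   infimum is +oo when f is not bi-Lipschitz. *)
Definition distortion (p : \bar R) (p1 : (1 <= p)%E) (f : T -> Lp p1) : \bar R :=
  ereal_inf [set K%:E | K in [set K : R | 0 < K /\ bi_lipschitz K f]].

Definition Lp_distortion (p : \bar R) (p1 : (1 <= p)%E) : \bar R :=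
  ereal_inf (range (@distortion p p1)).

End Embeddings.

Section PaddedDecompositions.
Variables (R : realType) (T : finMetricType R).

Definition oball (x : T) (r : R) : {set T} := [set y | mdist x y < r]%SET.

Definition diam (A : {set T}) : R :=
  \big[Num.max/0]_(x in A) \big[Num.max/0]_(y in A) mdist x y.

(* T being finite, a distribution over its partitions is a mass function. *)
Record partition_distr := PartitionDistr {
  pmass :> {ffun {set {set T}} -> R} ;
  pmass_ge0 : forall P, 0 <= pmass P ;
  pmass_sum1 : \sum_P pmass P = 1 ;
  pmass_partition : forall P, pmass P != 0 -> finset.partition P [set: T]%SET }.

Definition partition_prob (D : partition_distr) (E : pred {set {set T}}) : R :=
  \sum_(P | E P) D P.

Definition padded_decomposition (Delta : R) (eps : T -> R) (D : partition_distr) :=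
  [/\ 0 < Delta,
      forall x : T, 0 < eps x <= 1,
      forall P : {set {set T}}, D P != 0 ->
        forall C : {set T}, C \in P -> diam C <= Delta &
      forall x : T,
        partition_prob D [pred P : {set {set T}} |
          ~~ (oball x (eps x * Delta) \subset finset.pblock P x)] <= 2^-1].

Definition padded_bundle (eps : T -> int -> R) (beta : int -> partition_distr) :=
  forall u : int, padded_decomposition (2 ^ u) (eps^~ u) (beta u).

Definition padded_modulus : \bar R :=
  ereal_inf [set a%:E | a in [set a : R |
    exists beta, padded_bundle (fun _ _ => a^-1) beta]].

End PaddedDecompositions.

Arguments Lp_distortion {R} T {p} p1.

(* Main.v *)
Require Import Defs.
From HB Require Import structures.
From mathcomp Require Import all_boot all_order all_algebra.
From mathcomp Require Import all_classical all_reals all_analysis.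
From mathcomp Require Import measurable_realfun ess_sup_inf zify lra ring.
Import Order.TTheory GRing.Theory Num.Theory.
Import numFieldNormedType.Exports.
Local Open Scope ring_scope.

Set Implicit Arguments.
Unset Strict Implicit.
Unset Printing Implicit Defensive.

(** Every coordinate of the embedding is a distance [x |-> d(x, A)] to a random
    subset [A], so the upper Lipschitz bound is free.  Since
    [b^p >= s^(p-1) (b - s)^+], it suffices to bound from below, by a multiple of
    [D / log n] with [D = d(x, y)], the expected excess of [|d(x,A) - d(y,A)|] over
    a threshold [s] of order [D / alpha]; this no longer involves [p].

    The law of [A] is an even mixture, over the [O(log n)] levels [t], of two
    constructions.  In Bourgain's, [A] contains each point with probability
    [2^-(t+1)].  In measured descent, each point [z] looks at the scale where its
    ball reaches [2^(t+1)] points, and [A] is the set of the [z] whose cluster in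
    the random partition of that scale receives the colour 1.  Let [k] be the
    number of levels at which the smaller of the two balls around [x] and [y] grows
    when its radius goes from [D/8] to [D/4].  At each of those levels, measured
    descent separates [x] and [y] by [D / alpha] with constant probability, which
    settles the case [k >= alpha].  The Bourgain coordinates at these levels gain
    [D] in total; subtracting the threshold [k] times leaves a multiple of [D]
    when [k = O(alpha)]. *)

(** * Norm bounds on a probability space *)

Section LnormBasics.
Local Open Scope classical_set_scope.
Context d (X : measurableType d) (R : realType) (mu : {measure set X -> \bar R}).
Implicit Types (f g : X -> R) (p : \bar R).

Lemma ae_eq_Lnorm p f g :
  measurable_fun setT f -> measurable_fun setT g ->
  (\forall x \ae mu, f x = g x) ->
  'N[mu]_p[EFin \o f]%E = 'N[mu]_p[EFin \o g]%E.
Proof.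
move=> mf mg fg; rewrite unlock; case: p => [r||].
- congr poweR; apply: ae_eq_integral => //.
  + by apply/measurable_EFinP; apply: (measurableT_comp (measurable_powR r));
      exact: measurableT_comp.
  + by apply/measurable_EFinP; apply: (measurableT_comp (measurable_powR r));
      exact: measurableT_comp.
  + by apply: filterS fg => x /= -> _.
- by case: ifP => // _; apply: eq_ess_sup; apply: filterS fg => x /= ->.
- by case: ifP => // _; apply: eq_ess_inf; apply: filterS fg => x /= ->.
Qed.

Lemma Lnorm_le_bound p f (D : R) :
  (1 <= p)%E -> mu setT = 1%E -> measurable_fun setT f -> 0 <= D ->
  (forall x, `|f x| <= D) -> ('N[mu]_p[EFin \o f] <= D%:E)%E.
Proof.
move=> p1 mu1 mf D0 fD; rewrite unlock; case: p p1 => [r|_|//].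
- rewrite lee_fin => r1; have r0 : 0 < r by exact: lt_le_trans r1.
  have -> : D%:E = ((D `^ r)%:E `^ r^-1)%E.
    by rewrite poweR_EFin -powRrM mulfV ?gt_eqF// powRr1.
  apply: gt0_ler_poweR; rewrite ?invr_ge0 ?(ltW r0)// ?in_itv/= ?leey ?andbT//.
  + by apply: integral_ge0 => x _; rewrite lee_fin powR_ge0.
   + by rewrite lee_fin powR_ge0.
   have -> : (D `^ r)%:E = (\int[mu]_x (D `^ r)%:E)%E.
    by rewrite integral_cst// mu1 mule1.
  apply: ge0_le_integral => //.
  + by apply/measurable_EFinP; apply: (measurableT_comp (measurable_powR r));
      exact: measurableT_comp.
  + move=> x _ /=; rewrite lee_fin; apply: ge0_ler_powR => //; first exact: ltW.
- rewrite mu1 lte01; apply/ess_supP; apply: nearW => x /=.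
  by rewrite lee_fin.
Qed.

(* Since [a^r >= s^(r-1) (a - s)^+], the excess of [|f|] over [s] controls all
   the norms at once. *)
Lemma Lnorm_ge_excess p f (s w : R) :
  (1 <= p)%E -> mu setT = 1%E -> measurable_fun setT f -> 0 < s -> 0 < w ->
  (w%:E <= \int[mu]_x (Num.max 0 (`|f x| - s))%:E)%E ->
  ((s `^ (1 - fine p^-1) * w `^ fine p^-1)%:E <= 'N[mu]_p[EFin \o f])%E.
Proof.
move=> p1 mu1 mf s0 w0 hw.
have mm : measurable_fun setT (fun x => (Num.max 0 (`|f x| - s))%:E).
  apply/measurable_EFinP; apply: measurable_maxr => //.
  by apply: measurable_funB => //; exact: measurableT_comp.
rewrite unlock; case: p p1 => [r|_|//].
- rewrite lee_fin => r1; have r0 : 0 < r by exact: lt_le_trans r1.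
  rewrite inver gt_eqF//=.
  have -> : s `^ (1 - r^-1) * w `^ r^-1 = (s `^ (r - 1) * w) `^ r^-1.
    rewrite powRM ?powR_ge0 ?ltW// -powRrM; congr (_ `^ _ * _).
    by field; rewrite gt_eqF.
  rewrite -poweR_EFin; apply: gt0_ler_poweR;
    rewrite ?invr_ge0 ?(ltW r0)// ?in_itv/= ?leey ?andbT//.
  + by rewrite lee_fin mulr_ge0 ?powR_ge0// ltW.
  + by apply: integral_ge0 => x _; rewrite lee_fin powR_ge0.
  apply: (@le_trans _ _ (\int[mu]_x ((s `^ (r - 1))%:E *
                                    (Num.max 0 (`|f x| - s))%:E))%E).
    rewrite ge0_integralZl//.
    + by rewrite EFinM; apply: lee_wpmul2l => //; rewrite lee_fin powR_ge0.
    + by move=> x _; rewrite lee_fin le_max lexx.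
    + by rewrite lee_fin powR_ge0.
  apply: ge0_le_integral => //.
  + by move=> x _; rewrite -EFinM lee_fin mulr_ge0 ?powR_ge0// le_max lexx.
  + exact: measurable_funeM.
  + by apply/measurable_EFinP; apply: (measurableT_comp (measurable_powR r));
      exact: measurableT_comp.
  + move=> x _ /=; rewrite lee_fin.
    case: (leP `|f x| s) => [fs|sf].
      by rewrite max_l ?subr_le0// mulr0 powR_ge0.
    rewrite max_r ?subr_ge0 ?(ltW sf)//.
    apply: (@le_trans _ _ (`|f x| `^ (r - 1) * `|f x|)); last first.
      by rewrite mulrC mulr_powRB1.
    apply: ler_pM; rewrite ?powR_ge0 ?subr_ge0 ?(ltW sf)//.
      by apply: ge0_ler_powR; rewrite ?subr_ge0 ?nnegrE ?(ltW s0) ?(ltW sf).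
    by rewrite lerBlDr lerDl ltW.
(* For [p = +oo] the claim reduces to [s <= ess sup |f|]: otherwise the excess would vanish almost
   everywhere, against [0 < w]. *)
- rewrite mu1 lte01 invey/= subr0 powRr1 ?(ltW s0)// powRr0 mulr1.
  rewrite leNgt; apply/negP => /ltW/ess_supP hs.
  have : (\int[mu]_x (Num.max 0 (`|f x| - s))%:E <= \int[mu]_x 0)%E.
    apply: ae_ge0_le_integral => //.
      by move=> x _; rewrite lee_fin le_max lexx.
    apply: filterS hs => x /=; rewrite lee_fin => fs _.
    by rewrite lee_fin max_l// subr_le0.
  rewrite integral0 => /(le_trans hw).
  by rewrite lee_fin leNgt w0.
Qed.

End LnormBasics.

(** * Finite distributions modelled by step functions on the unit interval *)

Section StepFunctions.
Local Open Scope classical_set_scope.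
Context (R : realType) (I : finType) (nu : I -> R).
Hypothesis nu_ge0 : forall i, 0 <= nu i.
Hypothesis nu_sum1 : \sum_i nu i = 1.

(** Partial sums of [nu] in enumeration order. They cut [[0, 1[] into consecutive intervals of
    lengths [nu i], so that [step_fun v] has under [unit_measure] the law of [v] under [nu]. *)
Let cut (k : nat) : R := \sum_(i | (enum_rank i < k)%N) nu i.

Let step_itv (i : I) : set R :=
  `[cut (enum_rank i), cut (enum_rank i).+1[%classic.

Definition step_fun (v : I -> R) (w : R) : R := \sum_i v i * \1_(step_itv i) w.

Let cut_le (j k : nat) : (j <= k)%N -> cut j <= cut k.
Proof.
move=> jk; rewrite /cut [leRHS](bigID (fun i => enum_rank i < j)%N)/=.
rewrite [X in _ <= X + _](eq_bigl (fun i => (enum_rank i < j)%N)) ?lerDl ?sumr_ge0//.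
by move=> i; case: (ltnP (enum_rank i) j) => [ij|_]; rewrite ?andbF// (leq_trans ij jk).
Qed.

Let cutS (i : I) : cut (enum_rank i).+1 = cut (enum_rank i) + nu i.
Proof.
rewrite /cut (bigD1 i)//= addrC; congr (_ + _); apply: eq_bigl => j.
rewrite ltnS [in RHS]ltn_neqAle andbC; congr (_ && _).
by rewrite -(inj_eq enum_rank_inj).
Qed.

Let step_itv_disj (i j : I) (w : R) : step_itv i w -> step_itv j w -> i = j.
Proof.
rewrite /step_itv /= !in_itv/= => /andP[i1 i2] /andP[j1 j2].
apply: enum_rank_inj; apply: val_inj => /=; case: (ltngtP (enum_rank i) (enum_rank j)) => // ij.
- by have := lt_le_trans i2 (le_trans (cut_le ij) j1); rewrite ltxx.
- by have := lt_le_trans j2 (le_trans (cut_le ij) i1); rewrite ltxx.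
Qed.

Let step_funE (v : I -> R) (i : I) (w : R) : step_itv i w -> step_fun v w = v i.
Proof.
move=> iw; rewrite /step_fun (bigD1 i)//= indicE mem_set// mulr1 big1 ?addr0//.
move=> j ji; rewrite indicE memNset ?mulr0// => jw; move/eqP: ji; apply.
exact: step_itv_disj jw iw.
Qed.

(** At most one interval contains [w]; the condition on [phi 0] handles the points outside all of
    them, where every step function is 0. *)
Lemma step_fun_map (phi : R -> R) (v : I -> R) (w : R) : phi 0 = 0 ->
  phi (step_fun v w) = step_fun (phi \o v) w.
Proof.
move=> phi0; have [[i iw]|no] := pselect (exists i, step_itv i w).
  by rewrite !(step_funE _ iw).
have step0 u : step_fun u w = 0.
  rewrite /step_fun big1// => i _; rewrite indicE memNset ?mulr0// => iw.
  by apply: no; exists i.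
by rewrite !step0.
Qed.

Lemma step_funB (v v' : I -> R) (w : R) :
  step_fun v w - step_fun v' w = step_fun (fun i => v i - v' i) w.
Proof. by rewrite /step_fun -sumrB; apply: eq_bigr => i _; rewrite mulrBl. Qed.

Lemma unit_measureT : unit_measure R setT = 1%E.
Proof.
rewrite /unit_measure/= /mrestr setTI lebesgue_measure_itv/= lte_fin ltr01.
by rewrite -EFinB subr0.
Qed.

Let unit_measure_step (i : I) : unit_measure R (step_itv i) = (nu i)%:E.
Proof.
rewrite /unit_measure/= /mrestr setIidl; last first.
  move=> w; rewrite /step_itv /= !in_itv/= => /andP[w1 w2].
  rewrite (le_trans _ w1) ?sumr_ge0//= (le_trans (ltW w2))//.
  rewrite -nu_sum1 [leRHS](bigID (fun j => enum_rank j < (enum_rank i).+1)%N)/=.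
  by rewrite lerDl sumr_ge0.
rewrite lebesgue_measure_itv/= lte_fin cutS; case: ltP => [_|].
  by rewrite -EFinB addrC addKr.
(* An empty interval: here [nu i <= 0], hence [nu i = 0]. *)
by rewrite gerDl => h; congr EFin; apply/eqP; rewrite eq_le h nu_ge0.
Qed.

Let measurable_step (i : I) : measurable (step_itv i : set (measurableTypeR R)).
Proof. exact: measurable_itv. Qed.

Let integral_step (i : I) :
  (\int[unit_measure R]_w (\1_(step_itv i) w)%:E = (nu i)%:E)%E.
Proof.
have := @integral_indic _ (measurableTypeR R) R (unit_measure R) setT
  measurableT _ (measurable_step i).
by rewrite setIT unit_measure_step.
Qed.

Let measurable_step_indic (i : I) : measurable_fun setT
  (\1_(step_itv i) : measurableTypeR R -> R).
Proof. exact: (measurable_indic (measurable_step i)). Qed.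

Lemma measurable_step_fun (v : I -> R) :
  measurable_fun setT (step_fun v : measurableTypeR R -> R).
Proof. by apply: measurable_sum => i; apply: measurable_funM. Qed.

Lemma integral_step_fun (v : I -> R) : (forall i, 0 <= v i) ->
  (\int[unit_measure R]_w (step_fun v w)%:E = (\sum_i nu i * v i)%:E)%E.
Proof.
move=> v0; rewrite /step_fun.
under eq_integral do rewrite -sumEFin.
rewrite ge0_integral_sum//.
- rewrite -sumEFin; apply: eq_bigr => i _.
  under eq_integral do rewrite EFinM.
  rewrite ge0_integralZl//.
  + by rewrite integral_step -EFinM mulrC.
  + by apply/measurable_EFinP; exact: measurable_step_indic.
  + by rewrite lee_fin.
- by move=> i; apply/measurable_EFinP; apply: measurable_funM.
- by move=> i w _; rewrite lee_fin mulr_ge0.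
Qed.

End StepFunctions.

(** * From finitely many random coordinates to a map into L_p *)

Section LpRealization.
Local Open Scope classical_set_scope.
Context (R : realType) (p : \bar R) (p1 : (1 <= p)%E).
Local Open Scope quotient_scope.
Local Notation mR := (measurableTypeR R).

(** Elements of [Lp p1] are quotient classes whose chosen representative agrees with [h] only almost
    everywhere. This is enough for the norm, which is finite because [h] is bounded. *)
Lemma Lp_class (h : mR -> R) (D : R) :
  measurable_fun setT h -> 0 <= D -> (forall w, `|h w| <= D) ->
  exists f : Lp p1, measurable_fun setT (f : mR -> R) /\
    (\forall w \ae unit_measure R, (f : mR -> R) w = h w).
Proof.
move=> mh D0 hD.
have mh' : measurable_fun setT (h : mR -> mR) := mh.
pose hm : {mfun mR >-> mR} :=
  HB.pack_for {mfun mR >-> mR} h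
    (isMeasurableFun.Build _ _ mR mR h mh').
pose q : {mfun_ (unit_measure R), mR >-> mR} := \pi hm.
have qh : \forall w \ae unit_measure R, (q : mR -> R) w = h w.
  have /eqmodP : repr q = hm %[mod {eq_quot (ae_eq_op (unit_measure R))}].
    by rewrite reprK.
  by move=> /asboolP; apply: filterS => w /= /(_ I).
have mq' : measurable_fun setT (repr q : mR -> mR).
  exact: measurable_funPT.
have mq : measurable_fun setT (q : mR -> R) := mq'.
have fq : finite_norm (unit_measure R) p q.
  rewrite /finite_norm (ae_eq_Lnorm p mq mh qh).
  exact: le_lt_trans (Lnorm_le_bound p1 (@unit_measureT R) mh D0 hD) (ltry _).
by exists (HB.pack_for (LspaceType (unit_measure R) p1) q
  (isFinLebesgue.Build _ mR R (unit_measure R) p p1 q fq)).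
Qed.

(** Reduces the embedding to the choice of a finite distribution over coordinates [v _ i]. The first
    clause will give the upper Lipschitz bound, the second turns an expected excess into the lower
    one. *)
Lemma Lp_realization (T : Type) (I : finType) (nu : I -> R) (v : T -> I -> R) :
  (forall i, 0 <= nu i) -> \sum_i nu i = 1 ->
  exists f : T -> Lp p1, forall x y,
    (forall D, 0 <= D -> (forall i, `|v x i - v y i| <= D) ->
      (Lp_dist (f x) (f y) <= D%:E)%E) /\
    (forall s w, 0 < s -> 0 < w ->
      w <= \sum_i nu i * Num.max 0 (`|v x i - v y i| - s) ->
      ((s `^ (1 - fine p^-1) * w `^ fine p^-1)%:E <= Lp_dist (f x) (f y))%E).
Proof.
move=> nu0 nu1; pose h x : mR -> R := step_fun nu (v x).
have mh x : measurable_fun setT (h x) by exact: measurable_step_fun.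
have step_bound u D w : 0 <= D -> (forall i, `|u i| <= D) ->
    `|step_fun nu u w| <= D.
  move=> D0 uD; rewrite (step_fun_map nu0 (phi := fun a => `|a|)) ?normr0//.
  (* Truncation at [D] fixes 0 and all the values [|u i|], so it leaves the step function unchanged,
     which is therefore at most [D]. *)
  have -> : step_fun nu (Num.norm \o u) w =
      Num.min D (step_fun nu (Num.norm \o u) w).
    rewrite (step_fun_map nu0 (phi := fun a => Num.min D a)) ?min_r//.
    by congr step_fun; apply/funext => i /=; rewrite min_r.
  by rewrite ge_min lexx.
have hB x : exists D, 0 <= D /\ forall w, `|h x w| <= D.
  exists (\sum_i `|v x i|); split; first by rewrite sumr_ge0.
  move=> w; apply: step_bound; first by rewrite sumr_ge0.
  by move=> i; rewrite (bigD1 i)//= lerDl sumr_ge0.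
have /choice[f fP] : forall x, exists f : Lp p1, measurable_fun setT (f : mR -> R) /\
    (\forall w \ae unit_measure R, (f : mR -> R) w = h x w).
  by move=> x; have [D [D0 hD]] := hB x; exact: (Lp_class (mh x) D0 hD).
exists f => x y; have [mx fx] := fP x; have [my fy] := fP y.
have mB : measurable_fun setT (h x \- h y) by exact: measurable_funB.
have hBE w : (h x \- h y) w = step_fun nu (fun i => v x i - v y i) w.
  by rewrite /= step_funB.
have -> : Lp_dist (f x) (f y) = 'N[unit_measure R]_p[EFin \o (h x \- h y)%R]%E.
  apply: ae_eq_Lnorm => //; first exact: measurable_funB.
  by near=> w; rewrite /= (near fx w)// (near fy w).
split=> [D D0 xyD|s w s0 w0 hw].
  apply: Lnorm_le_bound => //; first exact: unit_measureT.
  by move=> w; rewrite hBE; exact: step_bound.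
apply: Lnorm_ge_excess => //; first exact: unit_measureT.
have -> : (\int[unit_measure R]_z (Num.max 0 (`|(h x \- h y) z| - s))%:E =
    (\sum_i nu i * Num.max 0 (`|v x i - v y i| - s))%:E)%E.
  rewrite -integral_step_fun//; last by move=> i; rewrite le_max lexx.
  apply: eq_integral => z _; rewrite hBE.
  rewrite (step_fun_map nu0 (phi := fun a => Num.max 0 (`|a| - s)))//.
  by rewrite normr0 sub0r max_l// oppr_le0 ltW.
by rewrite lee_fin.
Unshelve. all: by end_near. Qed.

End LpRealization.

(** * Finite probability spaces: images, products, random subsets *)

Section FiniteProbability.
Context (R : realType).

Definition is_mass (I : finType) (m : I -> R) :=
  (forall i, 0 <= m i) /\ \sum_i m i = 1.

Definition Pr (I : finType) (m : I -> R) (E : pred I) : R := \sum_(i | E i) m i.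

Definition push (I J : finType) (m : I -> R) (phi : I -> J) (j : J) : R :=
  \sum_(i | phi i == j) m i.

Lemma le_Pr (I : finType) (m : I -> R) (E F : pred I) : is_mass m ->
  (forall i, m i != 0 -> E i -> F i) -> Pr m E <= Pr m F.
Proof.
move=> [m0 _] EF; rewrite /Pr [leRHS](bigID E)/=.
rewrite -[leLHS]addr0 lerD ?sumr_ge0//.
rewrite [leRHS]big_mkcondl/=; apply: ler_sum => i Ei.
case: ifPn => // Fi; case: (eqVneq (m i) 0) => [->//|mi].
by rewrite (EF _ mi Ei) in Fi.
Qed.

Lemma Pr_push (I J : finType) (m : I -> R) (phi : I -> J) E :
  Pr (push m phi) E = Pr m (E \o phi).
Proof.
rewrite /Pr /push [RHS](partition_big phi E)//=; apply: eq_bigr => j Ej.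
by apply: eq_bigl => i; case: eqP => [->|]; rewrite ?Ej ?andbF.
Qed.

Lemma is_mass_push (I J : finType) (m : I -> R) (phi : I -> J) :
  is_mass m -> is_mass (push m phi).
Proof.
move=> [m0 m1]; split=> [j|]; first by rewrite /push sumr_ge0.
by rewrite -m1 [RHS](partition_big phi predT).
Qed.

Definition prod_mass (I J : finType) (m : I -> J -> R) (f : {ffun I -> J}) : R :=
  \prod_i m i (f i).

Lemma is_mass_prod (I J : finType) (m : I -> J -> R) :
  (forall i, is_mass (m i)) -> is_mass (prod_mass m).
Proof.
move=> mP; split=> [f|]; first by apply: prodr_ge0 => i _; have [] := mP i.
rewrite /prod_mass -(bigA_distr_bigA m) big1// => i _; by have [] := mP i.
Qed.

Lemma Pr_prod (I J : finType) (m : I -> J -> R) (E : I -> pred J) :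
  Pr (prod_mass m) [pred f : {ffun I -> J} | [forall i, E i (f i)]] =
  \prod_i Pr (m i) (E i).
Proof.
rewrite /Pr /prod_mass.
under [RHS]eq_bigr do rewrite big_mkcond/=.
rewrite bigA_distr_bigA/= big_mkcond/=; apply: eq_bigr => f _.
case: ifPn => [/forallP Ef|/forallPn[i Ei]].
  by apply: eq_bigr => i _; rewrite Ef.
by rewrite (bigD1 i)//= (negbTE Ei) mul0r.
Qed.

Definition pair_mass (I J : finType) (m : I -> R) (m' : J -> R) (u : I * J) : R :=
  m u.1 * m' u.2.

Lemma is_mass_pair (I J : finType) (m : I -> R) (m' : J -> R) :
  is_mass m -> is_mass m' -> is_mass (pair_mass m m').
Proof.
move=> [m0 m1] [m'0 m'1]; split=> [u|]; first by rewrite mulr_ge0.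
rewrite /pair_mass -(pair_bigA _ (fun i j => m i * m' j))/= -m1.
by apply: eq_bigr => i _; rewrite -mulr_sumr m'1 mulr1.
Qed.

(** Conditioning on the first coordinate, on which the second event may depend. *)
Lemma Pr_pair_ge (I J : finType) (m : I -> R) (m' : J -> R) (E : pred I)
    (F : I -> pred J) (c c' : R) :
  is_mass m -> is_mass m' -> 0 <= c' -> c <= Pr m E ->
  (forall i, m i != 0 -> E i -> c' <= Pr m' (F i)) ->
  c * c' <= Pr (pair_mass m m') [pred u | E u.1 && F u.1 u.2].
Proof.
move=> [m0 _] [m'0 _] c'0 cE c'F.
apply: (@le_trans _ _ (Pr m E * c')); first exact: ler_wpM2r.
rewrite /Pr /pair_mass mulr_suml -(pair_big_dep E F (fun i j => m i * m' j))/=.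
apply: ler_sum => i Ei; rewrite -mulr_sumr.
case: (eqVneq (m i) 0) => [->|mi]; first by rewrite !mul0r.
by apply: ler_wpM2l => //; exact: c'F.
Qed.

Definition bernoulli (I : finType) (q : R) (A : {set I}) : R :=
  \prod_i (if i \in A then q else 1 - q).

Lemma Pr_bernoulli_miss (I : finType) (q : R) (C : {set I}) :
  Pr (bernoulli q) [pred A : {set I} | [disjoint A & C]] = (1 - q) ^+ #|C|.
Proof.
(* Expanding this product gives one term per subset [A], which vanishes as soon as [A] meets [C]. *)
transitivity (\prod_i ((if i \in C then 0 else q) + (1 - q))).
  rewrite bigA_distr /Pr big_mkcond/=; apply: eq_bigr => A _.
  rewrite /bernoulli; case: ifPn => [AC|].
    apply: eq_bigr => i _; case: ifPn => // iA.
    by rewrite (disjointFr AC iA).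
  rewrite -setI_eq0 => /set0Pn[i]; rewrite inE => /andP[iA iC].
  by rewrite (bigD1 i)//= iA iC mul0r.
rewrite (bigID (mem C))/= [X in _ * X]big1 ?mulr1; last first.
  by move=> i /negbTE ->; rewrite addrC subrK.
under eq_bigr => i iC do rewrite iC add0r.
by rewrite prodr_const.
Qed.

Lemma is_mass_bernoulli (I : finType) (q : R) :
  0 <= q <= 1 -> is_mass (bernoulli (I := I) q).
Proof.
move=> /andP[q0 q1]; split=> [A|].
  by apply: prodr_ge0 => i _; case: ifP; rewrite ?subr_ge0.
(* The total mass is the probability of missing the empty set. *)
have := Pr_bernoulli_miss q (@finset.set0 I); rewrite cards0 expr0 => <-.
by rewrite /Pr; apply: eq_bigl => A; rewrite /= -setI_eq0 finset.setI0 eqxx.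
Qed.

(** From the probability of missing [C], subtract that of missing the disjoint union of [B] and
    [C]. *)
Lemma Pr_bernoulli_hit_miss (I : finType) (q : R) (B C : {set I}) :
  [disjoint B & C] ->
  Pr (bernoulli q) [pred A : {set I} | ~~ [disjoint A & B] && [disjoint A & C]] =
  (1 - (1 - q) ^+ #|B|) * (1 - q) ^+ #|C|.
Proof.
move=> BC; rewrite mulrBl mul1r -exprD -cardsUI.
move: (BC); rewrite -setI_eq0 => /eqP ->; rewrite cards0 addn0.
rewrite -!Pr_bernoulli_miss /Pr [X in _ = X - _](bigID [pred A : {set I} | [disjoint A & B]])/=.
rewrite [X in _ = X + _ - _](eq_bigl [pred A : {set I} | [disjoint A & B :|: C]]); last first.
  move=> A /=; rewrite -!setI_eq0 finset.setIUr finset.setU_eq0 andbC //.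
by rewrite addrAC subrr add0r; apply: eq_bigl => A; rewrite /= andbC.
Qed.

End FiniteProbability.

(** * Balls, distances to sets, expected excess *)

Section Balls.
Context (R : realType) (T : finMetricType R).
Implicit Types (x y z : T) (A : {set T}) (r s : R) (nu : {set T} -> R).

Lemma mdist_le_diam A x y : x \in A -> y \in A -> mdist x y <= diam A.
Proof.
move=> xA yA; rewrite /diam.
apply: (le_trans _ (le_bigmax_cond _ _ xA)).
exact: (le_bigmax_cond _ (fun y => mdist x y) yA).
Qed.

Lemma diam_ge0 A : 0 <= diam A.
Proof. exact: bigmax_ge_id. Qed.

Lemma diam_le A r : 0 <= r -> (forall x y, x \in A -> y \in A -> mdist x y <= r) ->
  diam A <= r.
Proof.
by move=> r0 Ar; apply: bigmax_le => // x xA; apply: bigmax_le => // y; exact: Ar.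
Qed.

Lemma oball_sub x y r s : mdist x y + r <= s -> oball y r \subset oball x s.
Proof.
move=> rs; apply/fintype.subsetP => z; rewrite !inE => yz.
apply: (le_lt_trans (metric_triangle x y z)).
by apply: lt_le_trans rs; rewrite ltrD2l.
Qed.

Lemma card_oball_le x y r s : mdist x y + r <= s -> (#|oball y r| <= #|oball x s|)%N.
Proof. by move=> h; apply/subset_leq_card/oball_sub. Qed.

Lemma card_oball_mono x r s : r <= s -> (#|oball x r| <= #|oball x s|)%N.
Proof. by move=> h; apply: card_oball_le; rewrite mdistxx add0r. Qed.

Lemma lt_card_oball x r s : (#|oball x r| < #|oball x s|)%N -> r < s.
Proof. by rewrite ltNge => h; apply/negP => /(card_oball_mono x); rewrite leqNgt h. Qed.

(* The cap [diam setT] gives the empty set a finite distance without affecting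
   nonempty sets, and keeps [dset A] 1-Lipschitz. *)
Definition dset A x : R := \big[Num.min/diam [set: T]]_(y in A) mdist x y.

Lemma dset_le A x y : y \in A -> dset A x <= mdist x y.
Proof. exact: bigmin_le_cond. Qed.

Lemma dset_ge A x r : r <= diam [set: T] -> (forall y, y \in A -> r <= mdist x y) ->
  r <= dset A x.
Proof. by move=> rM rA; apply: le_bigmin. Qed.

Lemma dset_lip A x y : `|dset A x - dset A y| <= mdist x y.
Proof.
have h u v : dset A u - mdist u v <= dset A v.
  apply: dset_ge.
    rewrite lerBlDr (le_trans (bigmin_le_id _ _ _ _))// lerDl mdist_ge0//.
  move=> w wA; rewrite lerBlDr (le_trans (dset_le _ wA))// addrC.
  exact: metric_triangle.
by rewrite ler_distl -lerBlDr h andbT metric_sym h.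
Qed.

Definition excess nu x y s : R :=
  \sum_A nu A * Num.max 0 (`|dset A x - dset A y| - s).

Lemma excess_sym nu x y s : excess nu x y s = excess nu y x s.
Proof. by apply: eq_bigr => A _; rewrite distrC. Qed.

Lemma excess_ge0 nu x y s : is_mass nu -> 0 <= excess nu x y s.
Proof. by move=> [nu0 _]; apply: sumr_ge0 => A _; rewrite mulr_ge0// le_max lexx. Qed.

(** A Markov-type bound: on the event, the excess is at least [b - s]. If [b < s] the left side is
    nonpositive. *)
Lemma excess_ge nu x y s b c : is_mass nu -> 0 <= c ->
  c <= Pr nu [pred A | b <= `|dset A x - dset A y|] ->
  c * (b - s) <= excess nu x y s.
Proof.
move=> nuP c0 cP; have [nu0 _] := nuP.
case: (leP s b) => [sb|bs]; last first.
  apply: (le_trans _ (excess_ge0 _ _ _ nuP)).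
  by rewrite mulr_ge0_le0// subr_le0 ltW.
apply: (@le_trans _ _ (Pr nu [pred A | b <= `|dset A x - dset A y|] * (b - s))).
  by rewrite ler_wpM2r ?subr_ge0.
rewrite /Pr mulr_suml big_mkcond/=; apply: ler_sum => A _.
case: ifPn => h; last by rewrite mulr_ge0// le_max lexx.
by rewrite ler_wpM2l// le_max lerD2r h orbT.
Qed.

End Balls.

(** * Bourgain's random subsets *)

Section Bourgain.
Context (R : realType) (T : finMetricType R).
Implicit Types (x y : T) (r s : R).

Lemma bernoulli_ineq (q : R) (n : nat) : 0 <= q -> 1 + n%:R * q <= (1 + q) ^+ n.
Proof.
move=> q0; elim: n => [|n IH]; first by rewrite mul0r addr0 expr0.
rewrite exprS; apply: (@le_trans _ _ ((1 + q) * (1 + n%:R * q))).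
  rewrite -natr1.
  have : 0 <= n%:R * q * q by rewrite !mulr_ge0.
  lra.
by rewrite ler_wpM2l// addr_ge0.
Qed.

(** With [q = 2^-(t+1)] and [N = 2^t], Bernoulli's inequality gives [(1 + q)^N >= 1 + N q = 3/2],
    while [(1 - q)^N (1 + q)^N <= 1]. *)
Lemma half_pow_hit (t : nat) : (1 - 2^-1 ^+ t.+1 : R) ^+ (2 ^ t) <= 2 / 3.
Proof.
set q : R := _ ^+ t.+1.
have q0 : 0 < q by rewrite exprn_gt0// invr_gt0.
have q1 : q <= 1 by rewrite exprn_ile1 ?invr_ge0// invf_le1 ?ler1n.
have tq : (2 ^ t)%:R * q = 2^-1.
  by rewrite /q exprS mulrCA natrX -exprMn divff ?expr1n ?mulr1.
have := bernoulli_ineq (2 ^ t) (ltW q0); rewrite tq => h.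
have : (1 - q) ^+ (2 ^ t) * (1 + q) ^+ (2 ^ t) <= 1.
  rewrite -exprMn exprn_ile1//; first by rewrite mulr_ge0 ?subr_ge0// addr_ge0// ltW.
  have : 0 <= q * q by rewrite mulr_ge0 ?ltW.
  lra.
have : 0 <= (1 - q) ^+ (2 ^ t) by rewrite exprn_ge0// subr_ge0.
nra.
Qed.

(** The sequence starts at [1/4] and is nondecreasing, because [1 - q <= (1 - q/2)^2]. *)
Lemma half_pow_miss (t : nat) : 4^-1 <= (1 - 2^-1 ^+ t.+1 : R) ^+ (2 ^ t.+1).
Proof.
elim: t => [|t IH]; first by rewrite expr1 expn1 expr2; lra.
apply: (le_trans IH); rewrite [in leRHS]expnS exprM.
have q1 : (2^-1 ^+ t.+1 : R) <= 1 by rewrite exprn_ile1 ?invr_ge0// invf_le1 ?ler1n.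
rewrite lerXn2r ?nnegrE ?exprn_ge0 ?subr_ge0//.
  by rewrite exprn_ile1 ?invr_ge0// invf_le1 ?ler1n.
rewrite expr2 [in leRHS]exprS.
have : 0 <= (2^-1 ^+ t.+1 : R) * 2^-1 ^+ t.+1 by rewrite mulr_ge0// exprn_ge0 ?invr_ge0.
lra.
Qed.

Definition bourgain_mass (t : nat) : {set T} -> R := bernoulli (2^-1 ^+ t.+1).

Lemma is_mass_bourgain t : is_mass (bourgain_mass t).
Proof.
apply: is_mass_bernoulli; rewrite exprn_ge0 ?invr_ge0//=.
by rewrite exprn_ile1 ?invr_ge0// invf_le1 ?ler1n.
Qed.

(** The two balls are disjoint, so [A] hits the one around [x] and misses the one around [y] with
    probability at least [1/3 * 1/4]; then [d(x, A) <= r] and [d(y, A) >= s]. *)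
Lemma Pr_bourgain t x y r s : r + s <= mdist x y -> 0 <= r ->
  (2 ^ t <= #|oball x r|)%N -> (#|oball y s| <= 2 ^ t.+1)%N ->
  12^-1 <= Pr (bourgain_mass t) [pred A | s - r <= `|dset A x - dset A y|].
Proof.
move=> rs r0 xr ys.
have dis : [disjoint oball x r & oball y s].
  apply/pred0P => z /=; rewrite !inE; apply/negP => /andP[xz yz].
  have := metric_triangle x z y; rewrite (metric_sym z) => h.
  by have := lt_le_trans (le_lt_trans h (ltrD xz yz)) rs; rewrite ltxx.
apply: (@le_trans _ _ (Pr (bourgain_mass t)
   [pred A : {set T} | ~~ [disjoint A & oball x r] && [disjoint A & oball y s]])).
  rewrite Pr_bernoulli_hit_miss//.
  have [q0 q1] : 0 <= 1 - 2^-1 ^+ t.+1 :> R /\ 1 - 2^-1 ^+ t.+1 <= 1 :> R.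
    rewrite subr_ge0 gerBl exprn_ge0 ?invr_ge0// exprn_ile1 ?invr_ge0//.
    by rewrite invf_le1 ?ler1n.
  have h1 := le_trans (ler_wiXn2l q0 q1 xr) (half_pow_hit t).
  have h2 := le_trans (half_pow_miss t) (ler_wiXn2l q0 q1 ys).
  have -> : 12^-1 = 3^-1 * 4^-1 :> R by rewrite -invfM -natrM.
  by apply: ler_pM; rewrite ?invr_ge0//; lra.
apply: le_Pr; first exact: is_mass_bourgain.
move=> A _ /andP[]; rewrite -setI_eq0 => /set0Pn[z].
rewrite !inE => /andP[zA xz] dy; apply: (@le_trans _ _ (dset A y - dset A x)); last first.
  by rewrite distrC ler_norm.
apply: lerB; last exact: (le_trans (dset_le _ zA) (ltW xz)).
apply: dset_ge.
  (* The cap in [dset] must also be at least [s]: this is where [0 <= r] enters. *)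
  apply: (@le_trans _ _ (mdist x y)); last by apply: mdist_le_diam; rewrite !inE.
  by apply: le_trans rs; rewrite lerDr.
move=> w wA; rewrite leNgt; apply/negP => yw.
by have := disjointFr dy wA; rewrite inE yw.
Qed.

End Bourgain.

(** * Randomly coloured padded partitions *)

Section ZeroSets.
Context (R : realType) (T : finMetricType R).
Implicit Types (x y z : T) (P : {set {set T}}).

(** [u.1] is the partition and [u.2] the family of sets coloured 0. All subsets of [T] are coloured,
    not only the clusters, so that the colouring is independent of the partition. *)
Definition zero_set (u : {set {set T}} * {set {set T}}) : {set T} :=
  [set z | finset.pblock u.1 z \in u.2].

Definition zero_set_mass (D : partition_distr T) : {set T} -> R :=
  push (pair_mass D (bernoulli 2^-1)) zero_set.

Let half01 : 0 <= (2^-1 : R) <= 1.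
Proof. by rewrite invr_ge0 ler0n invf_le1 ?ler1n. Qed.

Let is_mass_distr (D : partition_distr T) : is_mass D.
Proof. by split; [exact: pmass_ge0|exact: pmass_sum1]. Qed.

Lemma is_mass_zero_set D : is_mass (zero_set_mass D).
Proof.
by apply: is_mass_push; apply: is_mass_pair => //; exact: is_mass_bernoulli.
Qed.

(** The booleans select which requirements are imposed, so that one statement serves all scales.
    Padding at [x] has probability at least [1/2]; given the partition, the at most two prescribed
    colours have probability at least [1/4]. *)
Lemma Pr_zero_set (Delta : R) (eps : T -> R) D x y (bx by_ : bool) :
  padded_decomposition Delta eps D -> (bx && by_ -> Delta < mdist x y) ->
  8^-1 <= Pr (zero_set_mass D) [pred S : {set T} | (bx ==> (oball x (eps x * Delta) \subset S))
                                     && (by_ ==> (y \notin S))].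
Proof.
move=> [D0 eps01 Dd pad] xy; rewrite Pr_push.
pose E P := oball x (eps x * Delta) \subset finset.pblock P x.
pose F P (Q : {set {set T}}) :=
  (bx ==> (finset.pblock P x \in Q)) && (by_ ==> (finset.pblock P y \notin Q)).
have half4 : (2^-1 : R) * 4^-1 = 8^-1 by rewrite -invfM -natrM.
apply: (@le_trans _ _ (Pr (pair_mass D (bernoulli 2^-1))
    [pred u | E u.1 && F u.1 u.2])); last first.
  apply: le_Pr; first by apply: is_mass_pair => //; exact: is_mass_bernoulli.
  move=> [P Q]; rewrite /pair_mass mulf_eq0 negb_or => /andP[/= DP _].
  rewrite /E /F => /andP[/fintype.subsetP xP /andP[xQ yQ]].
  apply/andP; split; apply/implyP => b; last by rewrite inE (implyP yQ).
  apply/fintype.subsetP => z /xP zP; rewrite inE /=.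
  have /and3P[_ tI _] := pmass_partition DP.
  by rewrite (same_pblock tI zP) (implyP xQ).
rewrite -half4; apply: Pr_pair_ge => //.
- exact: is_mass_bernoulli.
- have -> : Pr D E = 1 - partition_prob D [pred P | ~~ E P].
    by rewrite -(pmass_sum1 D) /partition_prob [in RHS](bigID E)/= addrK.
  have : partition_prob D [pred P | ~~ E P] <= 2^-1 by exact: pad.
  lra.
move=> P DP _; rewrite /F {F}.
have mB : is_mass (bernoulli (I := {set T}) (2^-1 : R)) by exact: is_mass_bernoulli.
case: bx xy => xy; last first.
  apply: (@le_trans _ _ (Pr (bernoulli 2^-1)
      [pred Q : {set {set T}} | [disjoint Q & [set finset.pblock P y]%SET]])).
    by rewrite Pr_bernoulli_miss cards1 expr1; lra.
  apply: le_Pr => // Q _ /=.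
  by rewrite disjoint_sym disjoints1 => ->; rewrite implybT.
pose C : {set {set T}} := if by_ then [set finset.pblock P y]%SET else finset.set0.
have C1 : (#|C| <= 1)%N by rewrite /C; case: (by_); rewrite ?cards1 ?cards0.
(* If both colours are prescribed, [x] and [y] lie in different clusters, since a common one would
   have diameter above [Delta]; the colours are then independent. *)
have dC : [disjoint [set finset.pblock P x]%SET & C].
  rewrite disjoints1 /C; case: (by_) xy => [/(_ isT) xy|_]; rewrite inE//.
  apply/eqP => pxy; have /and3P[/eqP cP _ _] := pmass_partition DP.
  have pin z : z \in finset.pblock P z by rewrite mem_pblock cP inE.
  have px : finset.pblock P x \in P by rewrite pblock_mem// cP inE.
  have := mdist_le_diam (pin x); rewrite {1}pxy => /(_ _ (pin y)) h.
  by have := lt_le_trans xy (le_trans h (Dd _ DP _ px)); rewrite ltxx.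
apply: (@le_trans _ _ (Pr (bernoulli 2^-1) [pred Q : {set {set T}} |
    ~~ [disjoint Q & [set finset.pblock P x]%SET] && [disjoint Q & C]])).
  rewrite Pr_bernoulli_hit_miss// cards1 expr1.
  by case: #|C| C1 => [|[|//]] _; rewrite ?expr0 ?expr1; lra.
apply: le_Pr => // Q _ /= /andP[]; rewrite (disjoint_sym _ [set _]%SET) disjoints1 negbK => -> /=.
by rewrite /C; case: (by_) => //=; rewrite disjoint_sym disjoints1.
Qed.

End ZeroSets.

(** * Measured descent *)

Section Descent.
Context (R : realType) (T : finMetricType R).
Variables (a : R) (beta : int -> partition_distr T) (u0 : int) (M : nat).
Implicit Types (x y z : T) (N : nat).

(** A finite window of dyadic scales containing all those relevant to the distances of [T]; the
    decompositions of all its scales can then be drawn independently from a finite product. *)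
Definition scale (i : nat) : R := 2 ^ (u0 + i%:Z).

Hypothesis bundle : padded_bundle (fun _ _ => a^-1) beta.
Hypothesis scale_small : forall x y, x != y -> scale 0 <= mdist x y / 8.
Hypothesis scale_large : forall x y, mdist x y <= scale M.

Lemma scaleS i : scale i.+1 = 2 * scale i.
Proof. by rewrite /scale -(addn1 i) PoszD addrA [LHS]exprzDr ?unitfE//; exact: mulrC. Qed.

Lemma scale_gt0 i : 0 < scale i.
Proof. exact: exprz_gt0. Qed.

Lemma scale_le i j : (i <= j)%N -> scale i <= scale j.
Proof.
move=> /subnK <-; elim: (j - i)%N => [//|k IH]; rewrite addSn scaleS.
by have := scale_gt0 (k + i); lra.
Qed.

Lemma scale_lt_inv i j : scale i < scale j -> (i < j)%N.
Proof. by apply: contraTT; rewrite -leqNgt -leNgt; exact: scale_le. Qed.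

Lemma bundle_ge1 : (0 < #|T|)%N -> 1 <= a.
Proof.
move=> /card_gt0P[x _]; have [_ /(_ x)/andP[a0 a1] _ _] := bundle 0.
by move: a0 a1; rewrite invr_gt0 => a0; rewrite invf_le1.
Qed.

Let big_ball N z : pred nat := fun i => (N <= #|oball z (scale i)|)%N.

(** The first index below [M] whose ball around [z] has [N] points, and [M] by default; nothing is
    known about the ball in the default case. *)
Definition level N z : 'I_M.+1 := inord (find (big_ball N z) (iota 0 M)).

Let levelE N z : level N z = find (big_ball N z) (iota 0 M) :> nat.
Proof. by rewrite inordK// ltnS -[leqRHS](size_iota 0) find_size. Qed.

Lemma level_lt N z (i : nat) : (i < level N z)%N -> (#|oball z (scale i)| < N)%N.
Proof.
rewrite levelE => ik; have iM : (i < M)%N.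
  by apply: leq_trans ik _; rewrite -[leqRHS](size_iota 0) find_size.
by have := before_find 0%N ik; rewrite nth_iota// add0n /big_ball ltnNge => ->.
Qed.

Lemma level_ge N z : (level N z < M)%N -> (N <= #|oball z (scale (level N z))|)%N.
Proof.
rewrite levelE => kM.
have : has (big_ball N z) (iota 0 M) by rewrite has_find size_iota.
by move=> /(nth_find 0%N); rewrite nth_iota// add0n.
Qed.

Definition descent_set N (f : {ffun 'I_M.+1 -> {set T}}) : {set T} :=
  [set z | z \notin f (level N z)].

Definition descent_mass N : {set T} -> R :=
  push (prod_mass (fun i : 'I_M.+1 => zero_set_mass (beta (u0 + (i : nat)%:Z))))
       (descent_set N).

Lemma is_mass_descent N : is_mass (descent_mass N).
Proof. by apply/is_mass_push/is_mass_prod => i; exact: is_mass_zero_set. Qed.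

Section Pair.
Variables (N : nat) (x y : T).
Hypothesis xy : x != y.
Hypothesis small_lo : (#|oball x (mdist x y / 8)| < N)%N.
Hypothesis big_hi : (N <= #|oball x (mdist x y / 4)|)%N.

Let D := mdist x y.
Let D_gt0 : 0 < D. Proof. by rewrite mdist_gt0. Qed.

(** The ball around [x] reaches [N] points between radii [D/8] and [D/4]. The level is positive
    because [scale 0 <= D/8], and two more scales fit in the window because
    [4 * scale k < D <= scale M]. *)
Lemma level_pair : exists k : nat, [/\ level N x = k.+1 :> nat,
  (k.+2 <= M)%N, D / 16 < scale k & scale k < D / 4].
Proof.
have M_gt0 : (0 < M)%N.
  apply: scale_lt_inv; have := scale_small xy; have := scale_large x y.
  by have := D_gt0; rewrite /D; lra.
have hge : (level N x < M)%N -> D / 8 < scale (level N x).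
  by move=> /level_ge h; apply: lt_card_oball (leq_trans small_lo h).
have hlt i : (i < level N x)%N -> scale i < D / 4.
  by move=> /level_lt h; apply: lt_card_oball (leq_trans h big_hi).
case kE : (nat_of_ord (level N x)) hge hlt => [|k] hge hlt.
  by have := hge M_gt0; rewrite ltNge scale_small.
have hk := hlt k (ltnSn k).
have kM : (k.+2 < M)%N.
  apply: scale_lt_inv; rewrite !scaleS.
  by apply: (@lt_le_trans _ _ D); [lra|exact: scale_large].
exists k; split => //; first exact: ltnW.
by have := hge (ltnW kM); rewrite scaleS; lra.
Qed.

(** Moving the centre by less than [D/32], which is below half of [scale k], is absorbed by one
    doubling of the radius, so the level changes by at most one. *)
Lemma level_near (z : T) (k : nat) :
  level N x = k.+1 :> nat -> (k.+2 <= M)%N -> D / 16 < scale k ->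
  mdist x z < D / 32 -> (k <= level N z <= k.+2)%N.
Proof.
move=> kE kM Dk xz; apply/andP; split; rewrite leqNgt; apply/negP => hz.
- have hzM : (level N z < M)%N by apply: ltn_trans hz _; exact: leq_trans kM.
  have hk : (k < level N x)%N by rewrite kE.
  have := leq_trans (level_lt hk) (level_ge hzM); rewrite ltnNge => /negP; apply.
  apply: card_oball_le; have := scale_le hz; rewrite scaleS.
  by have := scale_gt0 k; lra.
- have := level_lt hz; rewrite ltnNge => /negP; apply.
  have hx : (level N x < M)%N by rewrite kE.
  apply: (leq_trans (level_ge hx)); rewrite kE; apply: card_oball_le.
  by rewrite metric_sym !scaleS; have := D_gt0; lra.
Qed.

(** Ask that [x] be padded with colour 0 at the scales [k], [k+1], [k+2], and that [y] have colour 1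
    at its own scale. This puts [y] in [A], while every [z] within [D / (32 * a)] of [x] reads one
    of those three scales and stays out of [A]. At most four independent scales are constrained,
    each at cost [1/8]. *)
Lemma Pr_descent :
  8^-1 ^+ 4 <= Pr (descent_mass N) [pred A | D / (32 * a) <= `|dset A x - dset A y|].
Proof.
have a1 : 1 <= a by apply: bundle_ge1; apply/card_gt0P; exists x.
have a0 : 0 < a by exact: lt_le_trans a1.
have [k [kE kM Dk kD]] := level_pair.
pose near (i : 'I_M.+1) := (k <= i <= k.+2)%N.
pose E (i : 'I_M.+1) := [pred S : {set T} |
  (near i ==> (oball x (a^-1 * scale i) \subset S)) &&
  ((i == level N y) ==> (y \notin S))].
pose J : {set 'I_M.+1} := [set inord k; inord k.+1; inord k.+2; level N y]%SET.
have J4 : (#|J| <= 4)%N.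
  have cU (A B : {set 'I_M.+1}) c d : (#|A| <= c)%N -> (#|B| <= d)%N ->
      (#|A :|: B| <= c + d)%N.
    by move=> Ac Bd; rewrite cardsU (leq_trans (leq_subr _ _))// leq_add.
  by rewrite /J (cU _ _ 3 1)%N ?(cU _ _ 2 1)%N ?(cU _ _ 1 1)%N ?cards1.
have nearJ i : near i -> i \in J.
  move=> /andP[ki ik]; have [k0 k1 k2] : [/\ (k < M.+1)%N, (k.+1 < M.+1)%N & (k.+2 < M.+1)%N].
    by split; move: kM; clear; lia.
  rewrite /J !inE -!val_eqE/= (inordK k0) (inordK k1) (inordK k2).
  by apply/orP; left; lia.
have PrE (i : 'I_M.+1) : 8^-1 <= Pr (zero_set_mass (beta (u0 + (i : nat)%:Z))) (E i).
  apply: (@Pr_zero_set _ _ _ (fun=> a^-1) _ x y (near i) (i == level N y)).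
    exact: bundle.
  (* When the scale of [y] is one of the three, it is at most [4 * scale k < D], so the clusters of
     [x] and [y] differ. *)
  move=> /andP[/andP[_ ik] _]; apply: (le_lt_trans (scale_le ik)).
  by rewrite !scaleS; have := kD; rewrite /D; lra.
have PrE1 (i : 'I_M.+1) : i \notin J -> Pr (zero_set_mass (beta (u0 + (i : nat)%:Z))) (E i) = 1.
  move=> iJ; have [_ <-] := is_mass_zero_set (beta (u0 + (i : nat)%:Z)).
  apply: eq_bigl => S /=; rewrite (negbTE (contra (@nearJ i) iJ)) /=.
  by case: eqP iJ => // ->; rewrite !inE eqxx orbT.
have PrAll : 8^-1 ^+ 4 <= \prod_(i < M.+1) Pr (zero_set_mass (beta (u0 + (i : nat)%:Z))) (E i).
  rewrite (bigID (mem J))/= [X in _ * X]big1 ?mulr1//.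
  apply: (@le_trans _ _ (\prod_(i in J) 8^-1)).
    rewrite prodr_const.
    by apply: ler_wiXn2l; rewrite ?invr_ge0// invf_le1 ?ler1n.
  by apply: ler_prod => i _; rewrite invr_ge0 PrE ler0n.
apply: (le_trans PrAll); rewrite -Pr_prod Pr_push.
apply: le_Pr; first by apply: is_mass_prod => i; exact: is_mass_zero_set.
move=> f _ /forallP Ef.
set A := descent_set N f.
have yA : y \in A.
  by rewrite inE; have /andP[_] := Ef (level N y); rewrite eqxx.
have dy : dset A y <= 0 by rewrite (le_trans (dset_le _ yA))// mdistxx.
have b_le : D / (32 * a) <= D / 32.
  by rewrite ler_pM2l// lef_pV2 ?posrE ?mulr_gt0// ler_peMr.
suff dx : D / (32 * a) <= dset A x.
  by rewrite /= (le_trans dx)// (le_trans _ (ler_norm _))// lerDl oppr_ge0.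
apply: dset_ge.
  apply: (le_trans b_le); apply: (@le_trans _ _ D); first by have := D_gt0; lra.
  by apply: mdist_le_diam; rewrite inE.
move=> z; rewrite inE; apply: contraNT; rewrite -ltNge => xz.
have nz := level_near kE kM Dk (lt_le_trans xz b_le).
have /andP[/implyP/(_ nz)/fintype.subsetP/(_ z) h _] := Ef (level N z).
apply: h; rewrite inE (lt_le_trans xz)// [leRHS]mulrC invfM mulrA ler_pM2r ?invr_gt0//.
have /andP[/scale_le hk _] := nz; lra.
Qed.

End Pair.
End Descent.

(** * Growth of the smaller ball between radii [D/8] and [D/4] *)

Section RadiusLevels.
Context (R : realType) (T : finMetricType R) (x y : T).
Hypothesis xy : x != y.
Implicit Types (r s : R) (t : nat).

Let D := mdist x y.
Let lo := D / 8.
Let hi := D / 4.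
Let D_gt0 : 0 < D. Proof. by rewrite mdist_gt0. Qed.

Definition min_ball r : nat := minn #|oball x r| #|oball y r|.

Lemma min_ball_mono r s : r <= s -> (min_ball r <= min_ball s)%N.
Proof.
by move=> rs; rewrite /min_ball leq_min !geq_min !card_oball_mono ?orbT.
Qed.

(** The disjunct [r = lo] keeps the set nonempty. Its supremum is the radius at which [min_ball]
    reaches [2^t], clamped to [[lo, hi]]. *)
Let low_radii t := [set r | lo <= r <= hi /\ (r = lo \/ (min_ball r < 2 ^ t)%N)]%classic.

Definition level_radius t : R := sup (low_radii t).

Let low_lo t : low_radii t lo.
Proof. by split; [rewrite lexx /lo /hi; have := D_gt0; lra|left]. Qed.

Let low_sup t : has_sup (low_radii t).
Proof. by split; [exists lo|exists hi => r [/andP[]]]. Qed.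

Lemma level_radius_le t : level_radius t <= hi.
Proof. by apply: ge_sup; [exists lo|move=> r [/andP[]]]. Qed.

Let lo_le t : lo <= level_radius t.
Proof. by apply: ub_le_sup; [case: (low_sup t)|]. Qed.

(** Balls of positive radius contain their centres, so no count is below [2^0]. With
    [level_radius_top], this gives the end values of the telescoping sum in [bourgain_sum]. *)
Lemma level_radius0 : level_radius 0 = lo.
Proof.
apply/eqP; rewrite eq_le lo_le andbT; apply: ge_sup; first by exists lo.
move=> r [/andP[r1 _] [->//|]]; rewrite expn0 ltnS leqn0 /min_ball => h.
have r0 : 0 < r by apply: lt_le_trans r1; rewrite /lo divr_gt0.
have : (0 < minn #|oball x r| #|oball y r|)%N; last by rewrite (eqP h).
rewrite leq_min !card_gt0; apply/andP; split; apply/set0Pn.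
  by exists x; rewrite inE mdistxx.
by exists y; rewrite inE mdistxx.
Qed.

Lemma level_radius_top t : (#|T| < 2 ^ t)%N -> level_radius t = hi.
Proof.
move=> nt; apply/eqP; rewrite eq_le level_radius_le/=.
apply: ub_le_sup; [by case: (low_sup t)|split].
  by rewrite lexx andbT /lo /hi; have := D_gt0; lra.
by right; rewrite (leq_ltn_trans _ nt)// geq_min max_card.
Qed.

Lemma min_ball_ge t r : level_radius t < r -> r <= hi -> (2 ^ t <= min_ball r)%N.
Proof.
move=> tr rhi; rewrite leqNgt; apply/negP => h.
have : r <= level_radius t; last by rewrite leNgt tr.
apply: ub_le_sup; [by case: (low_sup t)|split; last by right].
by rewrite rhi andbT (le_trans (lo_le t))// ltW.
Qed.

Lemma min_ball_lt t (e : R) : lo < level_radius t -> 0 < e ->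
  exists r, [/\ lo < r, level_radius t - e < r, r <= hi & (min_ball r < 2 ^ t)%N].
Proof.
(* The second entry forces [r > lo], which excludes the disjunct [r = lo]. *)
move=> lot e0; pose d := Num.min e (level_radius t - lo).
have d0 : 0 < d by rewrite lt_min e0 subr_gt0.
have [r [/andP[r1 r2] rN] rd] := sup_adherent d0 (low_sup t).
have lor : lo < r.
  by apply: le_lt_trans rd; rewrite lerBrDr -lerBrDl ge_min lexx orbT.
exists r; split => //.
  by apply: le_lt_trans rd; rewrite lerD2l lerN2 ge_min lexx.
by case: rN => // rE; rewrite rE ltxx in lor.
Qed.

Let gap t := level_radius t.+1 - level_radius t.

Lemma gap_level t : 0 < gap t -> (min_ball lo < 2 ^ t.+1)%N && (2 ^ t <= min_ball hi)%N.
Proof.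
rewrite subr_gt0 => g; have lt1 := le_lt_trans (lo_le t) g.
have [r [lor _ _ Nr]] := min_ball_lt lt1 ltr01.
rewrite (leq_ltn_trans (min_ball_mono (ltW lor)) Nr)/=.
by apply: (@min_ball_ge t) => //; apply: lt_le_trans g (level_radius_le _).
Qed.

(** A quarter of the gap is given up at each end: at [r] both balls have [2^t] points, and at [r']
    the smaller one has fewer than [2^(t+1)], with [r' - r] at least half the gap. Whichever centre
    has the small ball at [r'] plays the part of [y] in [Pr_bourgain]. *)
Lemma bourgain_gap t s : 0 <= s ->
  12^-1 * (gap t / 2 - s) <= excess (bourgain_mass t) x y s.
Proof.
move=> s0; have mB : is_mass (@bourgain_mass R T t) by exact: is_mass_bourgain.
case: (leP (gap t) 0) => [g0|g0].
  by apply: (le_trans _ (excess_ge0 _ _ _ mB)); lra.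
have g1 : level_radius t < level_radius t.+1 by rewrite -subr_gt0.
have lot := lo_le t; have thi := level_radius_le t.+1.
have [|r' [_ r'1 r'2 Nr']] := min_ball_lt (le_lt_trans lot g1) (e := gap t / 4).
  by rewrite divr_gt0.
pose r := level_radius t + gap t / 4.
have gE : level_radius t.+1 = level_radius t + gap t by rewrite /gap addrC subrK.
have Nr : (2 ^ t <= min_ball r)%N by apply: min_ball_ge; rewrite /r; lra.
have r0 : 0 <= r by rewrite /r; have := D_gt0; rewrite /lo in lot; lra.
have rr' : r + r' <= D by rewrite /r; have := D_gt0; rewrite /hi in thi r'2; lra.
apply: (@le_trans _ _ (12^-1 * (r' - r - s))); first by rewrite /r; lra.
move: Nr; rewrite /min_ball leq_min => /andP[Nx Ny].
move: Nr'; rewrite /min_ball gtn_min => /orP[] N'.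
  rewrite excess_sym; apply: excess_ge => //.
  by apply: Pr_bourgain => //; [rewrite metric_sym|exact: ltnW].
by apply: excess_ge => //; apply: Pr_bourgain => //; exact: ltnW.
Qed.

Lemma bourgain_sum (m : nat) (s : R) : 0 <= s -> (#|T| < 2 ^ m)%N ->
  12^-1 * (D / 16 - #|[set t : 'I_m | (min_ball lo < 2 ^ t.+1)%N &
                                     (2 ^ t <= min_ball hi)%N]%SET|%:R * s)
  <= \sum_(t < m) excess (bourgain_mass t) x y s.
Proof.
move=> s0 nm; set S := (X in #|X|%:R).
have gaps : \sum_(t < m) gap t = D / 8.
  rewrite -(big_mkord predT gap) telescope_sumr// level_radius0 level_radius_top//.
  by rewrite /lo /hi; lra.
have gapS : D / 8 <= \sum_(t in S) gap t.
  rewrite -gaps [leLHS](bigID (mem S))/= gerDl sumr_le0// => t.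
  by apply: contraNT; rewrite -ltNge inE => /gap_level.
rewrite [leRHS](bigID (mem S))/= -[leLHS]addr0 lerD//; last first.
  by apply: sumr_ge0 => t _; apply: excess_ge0; exact: is_mass_bourgain.
apply: (@le_trans _ _ (\sum_(t in S) 12^-1 * (gap t / 2 - s))); last first.
  by apply: ler_sum => t _; exact: bourgain_gap.
rewrite -mulr_sumr sumrB -mulr_suml sumr_const -[s *+ _]mulr_natl.
by rewrite ler_wpM2l// lerD2r; lra.
Qed.

End RadiusLevels.

(** * A window of dyadic scales adapted to the finite space *)

Section Scales.
Context (R : realType) (T : finMetricType R).
Implicit Types x y : T.

Lemma pow2_ge (r : R) : exists k : nat, r <= 2 ^+ k.
Proof.
exists (Num.bound `|r|); apply: (le_trans (ler_norm r)).
apply: (le_trans (ltW (archi_boundP (normr_ge0 r)))).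
by rewrite -natrX ler_nat ltnW// ltn_expl.
Qed.

Lemma min_mdist_gt0 : exists2 delta : R, 0 < delta &
  forall x y, x != y -> delta <= mdist x y.
Proof.
exists (\big[Num.min/1]_(u : T * T | u.1 != u.2) mdist u.1 u.2).
  by apply: lt_bigmin => // u; rewrite mdist_gt0.
by move=> x y xy; exact: (bigmin_le_cond _ (fun u : T * T => mdist u.1 u.2) (j := (x, y))).
Qed.

Lemma scale_exists : exists (u0 : int) (M : nat),
  (forall x y, x != y -> scale R u0 0 <= mdist x y / 8) /\
  (forall x y, mdist x y <= scale R u0 M).
Proof.
have [delta d0 dP] := min_mdist_gt0.
have [k kP] := pow2_ge (8 / delta).
have [M MP] := pow2_ge (diam [set: T] * 2 ^+ k).
have k0 : 0 < 2 ^+ k :> R by rewrite exprn_gt0.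
exists (- k%:Z), M; split=> [x y xy|x y].
  rewrite /scale addr0 -exprnN; apply: (@le_trans _ _ (delta / 8)).
    rewrite -[delta / 8]invrK lef_pV2 ?posrE ?invr_gt0 ?divr_gt0//.
    by rewrite invf_div.
  by rewrite ler_pM2r ?invr_gt0// dP.
rewrite /scale addrC exprzDr ?unitfE// -exprnN ler_pdivlMr//.
apply: le_trans MP; rewrite ler_pM2r//.
by apply: mdist_le_diam; rewrite inE.
Qed.

End Scales.

(** * The key estimate on the expected excess *)

Section KeyEstimate.
Context (R : realType) (T : finMetricType R).
Variables (a : R) (beta : int -> partition_distr T) (m : nat).
Hypothesis bundle : padded_bundle (fun _ _ => a^-1) beta.
Hypothesis card_lt : (#|T| < 2 ^ m)%N.
Hypothesis m_gt0 : (0 < m)%N.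

(* Levels [t] at which the descent coordinates separate [x] and [y] are counted
   by [J]: at least [a] of them suffice to compensate the padding loss [1 / a]; if
   there are fewer, at most [a + 1] radius levels cross [[D/8, D/4]] and the
   Bourgain coordinates gain [D / a] on average. *)
Lemma excess_levels (u0 : int) (M : nat) (x y : T) :
  (forall x y : T, x != y -> scale R u0 0 <= mdist x y / 8) ->
  (forall x y : T, mdist x y <= scale R u0 M) -> x != y ->
  mdist x y / 2 ^+ 18 <= \sum_(t < m)
    (excess (bourgain_mass t) x y (mdist x y / (64 * a)) +
     excess (descent_mass beta u0 M (2 ^ t.+1)) x y (mdist x y / (64 * a))).
Proof.
move=> small large xy; rewrite big_split/=.
have D0 : 0 < mdist x y by rewrite mdist_gt0.
have a1 : 1 <= a by apply: (bundle_ge1 bundle); apply/card_gt0P; exists x.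
have a0 : 0 < a by exact: lt_le_trans a1.
set D := mdist x y in D0 *; set s := D / (64 * a).
have s0 : 0 <= s by rewrite divr_ge0 ?mulr_ge0 ?ltW.
have sa : s * a = D / 64 by rewrite /s; field; rewrite gt_eqF.
have mBp t : 0 <= excess (bourgain_mass t) x y s.
  by apply: excess_ge0; exact: is_mass_bourgain.
have mDp N : 0 <= excess (descent_mass beta u0 M N) x y s.
  by apply: excess_ge0; exact: is_mass_descent.
pose lo := min_ball x y (D / 8); pose hi := min_ball x y (D / 4).
pose J := [set t : 'I_m | (lo < 2 ^ t.+1)%N & (2 ^ t.+1 <= hi)%N]%SET.
case: (leP a #|J|%:R) => [aJ|Ja].
  rewrite -[leLHS]add0r lerD ?sumr_ge0//.
  have desc t : t \in J ->
      8^-1 ^+ 4 * (D / (32 * a) - s) <= excess (descent_mass beta u0 M (2 ^ t.+1)) x y s.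
    rewrite inE => /andP[tlo thi].
    move: thi; rewrite /hi /min_ball leq_min => /andP[thix thiy].
    move: tlo; rewrite /lo /min_ball gtn_min => /orP[] tlo.
      apply: excess_ge; [exact: is_mass_descent|by rewrite exprn_ge0 ?invr_ge0|].
      exact: (Pr_descent bundle small large xy).
    rewrite excess_sym; apply: excess_ge; [exact: is_mass_descent|by rewrite exprn_ge0 ?invr_ge0|].
    rewrite /D metric_sym; apply: (Pr_descent bundle small large).
    - by rewrite eq_sym.
    - by rewrite metric_sym.
    - by rewrite metric_sym.
  apply: (@le_trans _ _ (\sum_(t in J) 8^-1 ^+ 4 * (D / (32 * a) - s))).
    rewrite sumr_const -[leRHS]mulr_natl.
    (* The threshold is half of the separation given by [Pr_descent]. *)
    have -> : D / (32 * a) - s = s by rewrite /s; field; rewrite gt_eqF.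
    apply: (@le_trans _ _ (a * (8^-1 ^+ 4 * s))); last first.
      by rewrite ler_wpM2r// mulr_ge0.
    have -> : a * (8^-1 ^+ 4 * s) = 8^-1 ^+ 4 * (s * a) by ring.
    (* This case fixes the constant: [8^-4 / 64 = 2^-18]. *)
    by rewrite sa; lra.
  rewrite [leRHS](bigID (mem J))/= -[leLHS]addr0 lerD ?sumr_ge0//.
  by apply: ler_sum => t; exact: desc.
rewrite -[leLHS]addr0 lerD ?sumr_ge0//.
pose S : {set 'I_m} := [set t : 'I_m | (lo < 2 ^ t.+1)%N & (2 ^ t <= hi)%N]%SET.
apply: (@le_trans _ _ (12^-1 * (D / 16 - #|S|%:R * s))); last first.
  exact: (bourgain_sum xy s0 card_lt).
(* A level of [S] outside [J] satisfies [2^t <= hi < 2^(t+1)], which determines [t]. *)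
have SJ1 : (#|S :\: J| <= 1)%N.
  apply/card_le1_eqP => t t'.
  rewrite !inE => /andP[tJ /andP[t1 t2]] /andP[t'J /andP[t'1 t'2]].
  rewrite t1/= -ltnNge in tJ; rewrite t'1/= -ltnNge in t'J.
  have := leq_ltn_trans t2 t'J; have := leq_ltn_trans t'2 tJ.
  rewrite !ltn_exp2l// !ltnS => tt' t't.
  by apply/val_inj/eqP; rewrite eqn_leq tt' t't.
have SJ : (#|S| <= #|J| + 1)%N.
  rewrite -(cardsID J S) leq_add//.
  by apply/subset_leq_card/fintype.subsetP => t; rewrite inE => /andP[].
have : (#|S|%:R : R) <= #|J|%:R + 1 by rewrite natr1 ler_nat -addn1.
(* From [#|J| < a] and [1 <= a]. The thresholds thus cost at most [D/32], half of the gain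
   [D/16]. *)
have : (#|J|%:R + 1) * s <= 2 * a * s by rewrite ler_wpM2r//; lra.
have -> : 2 * a * s = D / 32 by rewrite -mulrA [a * s]mulrC sa; lra.
move=> h1 /(ler_wpM2r s0) h2.
apply: (@le_trans _ _ (12^-1 * (D / 32))); last by rewrite ler_wpM2l//; lra.
lra.
Qed.

(** The uniform mixture of the [2 m] laws. The excess is linear in the law, so the sum over the
    levels is divided by [2 m]. *)
Lemma excess_mass_exists : exists2 nu : {set T} -> R, is_mass nu &
  forall x y : T, x != y ->
    mdist x y / (2 ^+ 19 * m%:R) <= excess nu x y (mdist x y / (64 * a)).
Proof.
have [u0 [M [small large]]] := scale_exists T.
have m0 : 0 < m%:R :> R by rewrite ltr0n.
pose nu A := (2 * m%:R)^-1 * \sum_(t < m)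
  (bourgain_mass t A + descent_mass beta u0 M (2 ^ t.+1) A).
exists nu.
  split=> [A|].
    apply: mulr_ge0; first by rewrite invr_ge0 mulr_ge0 ?ltW.
    apply: sumr_ge0 => t _.
    have [b0 _] := is_mass_bourgain T t.
    by have [d0 _] := is_mass_descent beta u0 M (2 ^ t.+1); rewrite addr_ge0.
  rewrite /nu -mulr_sumr exchange_big/=.
  under eq_bigr => t _.
    rewrite big_split/=; have [_ ->] := is_mass_bourgain T t.
    have [_ ->] := is_mass_descent beta u0 M (2 ^ t.+1); over.
  rewrite sumr_const card_ord -[(1 + 1) *+ m]mulr_natr.
  by field; rewrite gt_eqF.
move=> x y xy; set s := mdist x y / (64 * a).
have -> : excess nu x y s = (2 * m%:R)^-1 * \sum_(t < m)
    (excess (bourgain_mass t) x y s + excess (descent_mass beta u0 M (2 ^ t.+1)) x y s).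
  rewrite /excess /nu; under eq_bigr do rewrite -mulrA mulr_suml.
  rewrite -mulr_sumr exchange_big/=; congr (_ * _); apply: eq_bigr => t _.
  by rewrite -big_split/=; apply: eq_bigr => A _; rewrite mulrDl.
apply: (@le_trans _ _ ((2 * m%:R)^-1 * (mdist x y / 2 ^+ 18))); last first.
  apply: ler_wpM2l; first by rewrite invr_ge0 mulr_ge0 ?ltW.
  exact: excess_levels.
rewrite le_eqVlt; apply/orP; left; apply/eqP; rewrite exprS; field.
by rewrite gt_eqF.
Qed.

End KeyEstimate.

(** * Existence of some padded bundle *)

Section TrivialBundle.
Context (R : realType) (T : finMetricType R).
Implicit Types x y : T.

(** The point mass at the partition into fibres of [f], for which padding never fails. *)
Lemma preim_decomposition (rT : eqType) (f : T -> rT) (Delta e : R) :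
  0 < Delta -> 0 < e <= 1 ->
  (forall x y, f x = f y -> mdist x y <= Delta) ->
  (forall x y, mdist x y < e * Delta -> f x = f y) ->
  exists D : partition_distr T, padded_decomposition Delta (fun=> e) D.
Proof.
move=> D0 e01 fd fe; pose P0 := preim_partition f [set: T]%SET.
have P0P : finset.partition P0 [set: T]%SET by exact: preim_partitionP.
have /and3P[_ triv _] := P0P.
have pbE x y : (y \in finset.pblock P0 x) = (f x == f y).
  by rewrite /P0 /preim_partition pblock_equivalence_partition ?inE//;
     move=> u v w _ _ _; split=> //= /eqP ->.
pose mass : {ffun {set {set T}} -> R} := [ffun P => (P == P0)%:R].
have mass_eq P : mass P != 0 -> P = P0.
  by rewrite ffunE; have [//|_] := eqVneq P P0; rewrite eqxx.
have mass0 P : 0 <= mass P by rewrite ffunE ler0n.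
have mass1 : \sum_P mass P = 1.
  rewrite (bigD1 P0)//= ffunE eqxx big1 ?addr0// => P /negbTE PP0.
  by rewrite ffunE PP0.
have massP P : mass P != 0 -> finset.partition P [set: T]%SET by move=> /mass_eq ->.
exists (PartitionDistr mass0 mass1 massP); split => //=.
- move=> P /mass_eq -> C CP; apply: diam_le; first exact: ltW.
  by move=> x y xC yC; apply/fd/eqP; rewrite -pbE (def_pblock triv CP xC).
- move=> x; rewrite /partition_prob big1 ?invr_ge0// => P /=.
  apply: contraNeq => /mass_eq ->; apply/fintype.subsetP => y.
  by rewrite inE pbE => /fe ->.
Qed.

(** Makes the modulus finite: one cluster at the scales above the diameter, singletons below. *)
Lemma bundle_exists : exists (a : R) (beta : int -> partition_distr T),
  padded_bundle (fun _ _ => a^-1) beta.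
Proof.
have [delta d0 dP] := min_mdist_gt0 T.
(* Then [a >= 1] and [diam setT <= a * delta], so for [2^u] below the diameter the balls of radius
   [2^u / a] are singletons. *)
pose a : R := 1 + diam [set: T] / delta.
have a1 : 1 <= a by rewrite lerDl divr_ge0 ?diam_ge0// ltW.
have a0 : 0 < a by exact: lt_le_trans a1.
have ai : 0 < a^-1 <= 1 by rewrite invr_gt0 a0 invf_le1.
have h (u : int) : exists D : partition_distr T,
    padded_decomposition (2 ^ u : R) (fun=> a^-1) D.
  have u0 : 0 < 2 ^ u :> R by exact: exprz_gt0.
  case: (leP (diam [set: T]) (2 ^ u)) => [du|ud].
    apply: (preim_decomposition (f := fun=> tt)) => // x y _.
    by apply: le_trans du; apply: mdist_le_diam; rewrite inE.
  apply: (preim_decomposition (f := id)) => // x y.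
    by move=> ->; rewrite mdistxx ltW.
  move=> xy; apply/eqP/negPn/negP => /dP; rewrite leNgt => /negP; apply.
  apply: (lt_le_trans xy); rewrite ler_pdivrMl//.
  by rewrite mulrDl mul1r divfK ?gt_eqF// (le_trans (ltW ud))// lerDr ltW.
by have /choice[beta betaP] := h; exists a, beta.
Qed.

End TrivialBundle.

(** * The distortion of the embedding *)

Section DistortionBound.
Context (R : realType).

(** The entries are the factors of [D] in the lower bounds for [a * s] and [L * w] in
    [distortion_of_bundle]. *)
Definition lower_const : R := Num.min 64^-1 (ln 2 / 2 ^+ 20).

Lemma lower_const_gt0 : 0 < lower_const.
Proof.
rewrite lt_min invr_gt0 ltr0n/=; apply: divr_gt0; last exact: exprn_gt0.
by apply: ln_gt0; rewrite ltr1n.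
Qed.

Lemma inve_itv (p : \bar R) : (1 <= p)%E -> 0 <= fine p^-1 <= 1.
Proof.
case: p => [r|_|//]; last by rewrite invey/= lexx ler01.
rewrite lee_fin => r1; have r0 : 0 < r by exact: lt_le_trans r1.
by rewrite inver gt_eqF//= invr_ge0 ltW//= invf_le1.
Qed.

(** The coordinates are the functions [dset A], with [A] drawn from the law of [excess_mass_exists].
    Since [a * s] and [L * w] are both at least [c * D], so is their geometric mean with weights
    [1 - th] and [th], whatever [p]. *)
Lemma distortion_of_bundle (T : finMetricType R) (a : R)
    (beta : int -> partition_distr T) (p : \bar R) (p1 : (1 <= p)%E) :
  padded_bundle (fun _ _ => a^-1) beta -> (2 <= #|T|)%N ->
  (Lp_distortion T p1 <= (lower_const^-1 * a `^ (1 - fine p^-1)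
                            * ln #|T|%:R `^ fine p^-1)%:E)%E.
Proof.
move=> bundle n2; set th := fine p^-1; set n := #|T|; set c := lower_const.
have c0 : 0 < c by exact: lower_const_gt0.
have /andP[th0 th1] : 0 <= th <= 1 by exact: inve_itv.
have a1 : 1 <= a by apply: (bundle_ge1 bundle); exact: leq_trans n2.
have a0 : 0 < a by exact: lt_le_trans a1.
set L : R := ln n%:R.
have ln20 : 0 < ln 2 :> R by apply: ln_gt0; rewrite ltr1n.
have ln2L : ln 2 <= L by rewrite ler_ln ?posrE ?ltr0n ?ler_nat// ltnW.
have L0 : 0 < L by exact: lt_le_trans ln2L.
pose m := (trunc_log 2 n).+1.
have nm : (n < 2 ^ m)%N by exact: trunc_log_ltn.
have mn : (2 ^ (trunc_log 2 n) <= n)%N by rewrite trunc_logP// ltnW.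
(* The number of levels is at most [1 + log2 n], and the 1 is absorbed since [n >= 2]. *)
have mL : m%:R * ln 2 <= 2 * L.
  have : (trunc_log 2 n)%:R * ln 2 <= L.
    rewrite mulr_natl -lnXn// -natrX ler_ln ?posrE ?ltr0n ?ler_nat ?expn_gt0//.
    exact: ltnW.
  by rewrite /m -natr1; lra.
have [nu [nu0 nu1] nuP] := excess_mass_exists bundle nm (ltn0Sn _).
have [f fP] := Lp_realization p1 (fun x A => dset A x) nu0 nu1.
set K := (X in X%:E).
have K0 : 0 < K by rewrite !mulr_gt0 ?invr_gt0 ?powR_gt0.
apply: (@le_trans _ _ (distortion f)); first by apply: ereal_inf_lbound; exists f.
apply: ereal_inf_lbound; exists K => //; split => //; exists 1 => // x y.
have [hup hlow] := fP x y.
rewrite mul1r; apply/andP; split; last first.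
  by rewrite mul1r; apply: hup => [|A]; [exact: mdist_ge0|exact: dset_lip].
have [->|xy] := eqVneq x y; first by rewrite mdistxx mulr0; exact: Lnorm_ge0.
have D0 : 0 < mdist x y by rewrite mdist_gt0.
set D := mdist x y in D0 *.
have m0 : 0 < m%:R :> R by rewrite ltr0n.
have w0 : 0 < D / (2 ^+ 19 * m%:R) by rewrite divr_gt0// mulr_gt0// exprn_gt0.
have s0 : 0 < D / (64 * a) by rewrite divr_gt0// mulr_gt0.
apply: le_trans (hlow _ _ s0 w0 (nuP _ _ xy)).
rewrite lee_fin ler_pdivrMl// -/th.
set s := D / (64 * a); set w := D / _.
have -> : K * (s `^ (1 - th) * w `^ th) = c^-1 * ((a * s) `^ (1 - th) * (L * w) `^ th).
  by rewrite /K (powRM _ (ltW a0) (ltW s0)) (powRM _ (ltW L0) (ltW w0)); ring.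
have cD0 : 0 < c * D by rewrite mulr_gt0.
have cDs : c * D <= a * s.
  have -> : a * s = 64^-1 * D by rewrite /s; field; rewrite gt_eqF.
  by rewrite ler_pM2r// /c /lower_const ge_min lexx.
have cDw : c * D <= L * w.
  apply: (@le_trans _ _ (ln 2 / 2 ^+ 20 * D)).
    by rewrite ler_pM2r// /c /lower_const ge_min lexx orbT.
  have -> : L * w = (2 * L / m%:R) / 2 ^+ 20 * D.
    by rewrite /w (exprS 2 19); field; rewrite gt_eqF.
  rewrite ler_pM2r// ler_pM2r ?invr_gt0 ?exprn_gt0//.
  by rewrite ler_pdivlMr// mulrC.
rewrite ler_pdivlMl//; have -> : c * D = (c * D) `^ (1 - th) * (c * D) `^ th.
  by rewrite -powRD ?subrK ?powRr1 ?ltW// oner_eq0.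
by apply: ler_pM; rewrite ?powR_ge0// ge0_ler_powR ?nnegrE ?subr_ge0//;
  rewrite ?(ltW cD0)// (le_trans (ltW cD0)).
Qed.

End DistortionBound.

(** * Passage to the modulus of padded decomposability *)

Theorem theorem1p1 (R : realType) :
  exists2 C : R, 0 < C &
    forall (T : finMetricType R) (n : nat) (p : \bar R) (p1 : (1 <= p)%E),
      #|T| = n -> (2 <= n)%N ->
      (Lp_distortion T p1 <=
         C%:E * poweR (padded_modulus T) (1 - fine p^-1)
              * (ln n%:R `^ fine p^-1)%:E)%E.
Proof.
have c0 := lower_const_gt0 R.
exists (2 * (lower_const R)^-1); first by rewrite mulr_gt0 ?invr_gt0.
move=> T n p p1 <- n2; set th := fine p^-1.
have /andP[th0 th1] : 0 <= th <= 1 by exact: inve_itv.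
have T0 : (0 < #|T|)%N by exact: leq_trans n2.
have al1 : (1%:E <= padded_modulus T)%E.
  by apply: le_ereal_inf_tmp => _ [a [beta bP] <-]; rewrite lee_fin (bundle_ge1 bP).
have aly : (padded_modulus T < +oo)%E.
  have [a [beta bP]] := bundle_exists T.
  by apply: le_lt_trans (ltry a); apply: ereal_inf_lbound; exists a => //; exists beta.
have alE : padded_modulus T = (fine (padded_modulus T))%:E.
  by rewrite fineK// ge0_fin_numE// (le_trans _ al1).
move: al1; rewrite alE; set r := fine _; rewrite lee_fin => r1.
have r0 : 0 < r by exact: lt_le_trans r1.
(* The infimum need not be attained; some bundle has [a < 2 r], which costs the factor
   [2^(1 - th) <= 2] in the constant. *)
have [_ [a [beta bP] <-]] : exists2 y, [set a%:E | a in [set a : R |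
    exists beta : int -> partition_distr T, padded_bundle (fun _ _ => a^-1) beta]]%classic y
    & (y < (2 * r)%:E)%E.
  by apply: ereal_inf_lt; rewrite -/(padded_modulus T) alE lte_fin -/r; lra.
rewrite lte_fin => ar.
have a1 : 1 <= a by exact: (bundle_ge1 bP).
apply: (le_trans (distortion_of_bundle p1 bP n2)).
rewrite poweR_EFin -!EFinM lee_fin ler_wpM2r ?powR_ge0// [2 * _]mulrC -mulrA.
rewrite ler_wpM2l ?invr_ge0 ?(ltW c0)//.
have th1' : 0 <= 1 - th by rewrite subr_ge0.
apply: (@le_trans _ _ ((2 * r) `^ (1 - th))).
  apply: ge0_ler_powR => //; last exact: ltW.
    by rewrite nnegrE (le_trans _ a1).
  by rewrite nnegrE mulr_ge0// ltW.
rewrite powRM ?(ltW r0)// ler_wpM2r ?powR_ge0//.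
by rewrite ler1_powR ?ler1n// gerBl.
Qed.
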